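(* Let $n\ge 3$ be an integer and let $W_{n+1}$ be the wheel graph with $n+1$ vertices. (1) Suppose that $n$ is even. Then $I_{W_{n+1}}$ is subgraph splittable if and only if $n=4$. (2) If $n$ is odd, then $I_{W_{n+1}}$ is subgraph splittable.
   Context: Let $K$ be any field. For a finite simple graph $G$ with vertices $v_1,\dots,v_p$ and edge set $E(G)=\{e_1,\dots,e_q\}$, the edges are also used as variables of the polynomial ring $K[e_1,\dots,e_q]$, and the toric ideal $I_G\subset K[e_1,\dots,e_q]$ is the kernel of the $K$-algebra map $K[e_1,\dots,e_q]\to K[v_1,\dots,v_p]$ sending an edge $e=\{v_i,v_j\}$ to $v_iv_j$. For a subgraph $H$ of $G$ (not necessarily connected), $I_H$ is defined in the same way in the variables $E(H)$ and is regarded as the ideal it generates in $K[e_1,\dots,e_q]$. A subgraph splitting of $I_G$ is an equality $I_G=I_{G_1}+I_{G_2}$ with $G_1,G_2$ subgraphs of $G$, $I_{G_1}\neq I_G$ and $I_{G_2}\neq I_G$. $I_G$ is subgraph splittable if it has a subgraph splitting. The wheel graph $W_{n+1}$ ($n\ge3$) has vertices $v_1,\dots,v_{n+1}$ and $2n$ edges: the edges of the cycle $\{v_1,v_2\},\{v_2,v_3\},\dots,\{v_{n-1},v_n\},\{v_1,v_n\}$ of length $n$, together with the edges $\{v_i,v_{n+1}\}$ for $1\le i\le n$. *)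

(* Defs.v *)
From mathcomp Require Import all_boot all_order all_algebra.
From mathcomp.multinomials Require Import mpoly.

Set Implicit Arguments.
Unset Strict Implicit.
Unset Printing Implicit Defensive.

Import GRing.Theory.
Local Open Scope ring_scope.

(* A finite simple graph with vertices among the elements of V; edges are
   2-element sets of vertices.  Having an explicit vertex set makes G and its
   subgraphs inhabitants of the same type. *)
Record graph (V : finType) := Graph {
  verts : {set V};
  edges : {set {set V}};
  edgesP : [forall e in edges, (#|e| == 2)%N && (e \subset verts)]
}.

Definition subgraph (V : finType) (H G : graph V) : bool :=
  (verts H \subset verts G) && (edges H \subset edges G).

(* For a finite set A, {mpoly K[#|A|]} is the polynomial ring with one
   variable for each element of A: 'X_i stands for the element enum_val i. *)
Notation edge_ring K G := {mpoly K[#|edges G|]}.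
Notation vertex_ring K G := {mpoly K[#|verts G|]}.

(* For e = {u, v} the product below has exactly two factors, those of the
   variables u and v. *)
Definition edge_monomial (K : fieldType) (V : finType) (G : graph V)
    (i : 'I_#|edges G|) : vertex_ring K G :=
  \prod_(j < #|verts G| | enum_val j \in enum_val i) 'X_j.

Definition edge_map (K : fieldType) (V : finType) (G : graph V)
    (p : edge_ring K G) : vertex_ring K G :=
  comp_mpoly [tuple edge_monomial K i | i < #|edges G|] p.

Definition toric_ideal (K : fieldType) (V : finType) (G : graph V)
    (p : edge_ring K G) : Prop := edge_map p = 0.

Lemma subgraph_edge (V : finType) (H G : graph V) (sHG : subgraph H G)
  (i : 'I_#|edges H|) : enum_val i \in edges G.
Proof. by have /andP[_ /subsetP] := sHG; apply; apply: enum_valP. Qed.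

(* The inclusion K[E(H)] -> K[E(G)], sending the variable of an edge of H to
   the variable of the same edge in G. *)
Definition edge_incl (K : fieldType) (V : finType) (H G : graph V)
    (sHG : subgraph H G) (p : edge_ring K H) : edge_ring K G :=
  comp_mpoly
    [tuple 'X_(enum_rank_in (subgraph_edge sHG i) (enum_val i))
       | i < #|edges H|] p.

Definition ideal_gen (R : comNzRingType) (S : R -> Prop) (p : R) : Prop :=
  exists (m : nat) (a s : 'I_m -> R),
    (forall i, S (s i)) /\ p = \sum_(i < m) a i * s i.

Definition ideal_add (R : comNzRingType) (I J : R -> Prop) (p : R) : Prop :=
  exists a b : R, [/\ I a, J b & p = a + b].

Definition ideal_eq (R : comNzRingType) (I J : R -> Prop) : Prop :=
  forall p : R, I p <-> J p.

(* I_H regarded as an ideal of K[E(G)], for a subgraph H of G. *)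
Definition ext_toric_ideal (K : fieldType) (V : finType) (H G : graph V)
    (sHG : subgraph H G) : edge_ring K G -> Prop :=
  ideal_gen (fun p => exists2 q : edge_ring K H,
                        toric_ideal q & p = edge_incl sHG q).

Definition subgraph_splitting (K : fieldType) (V : finType)
    (G G1 G2 : graph V) (s1 : subgraph G1 G) (s2 : subgraph G2 G) : Prop :=
  let IG := @toric_ideal K V G in
  let I1 := @ext_toric_ideal K V G1 G s1 in
  let I2 := @ext_toric_ideal K V G2 G s2 in
  [/\ ideal_eq IG (ideal_add I1 I2), ~ ideal_eq I1 IG & ~ ideal_eq I2 IG].

Definition subgraph_splittable (K : fieldType) (V : finType) (G : graph V) :
    Prop :=
  exists (G1 G2 : graph V) (s1 : subgraph G1 G) (s2 : subgraph G2 G),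
    subgraph_splitting K s1 s2.

(* In W_(n+1) the vertices v_1, ..., v_n are 0, ..., n-1 and the hub v_(n+1)
   is ord_max; ordS is the cyclic successor on 'I_n. *)
Definition rim (n : nat) (i : 'I_n) : 'I_n.+1 := widen_ord (leqnSn n) i.

Definition wheel_edges (n : nat) : {set {set 'I_n.+1}} :=
  [set [set rim i; rim (ordS i)] | i : 'I_n]
    :|: [set [set rim i; ord_max] | i : 'I_n].

Lemma wheel_edgesP (n : nat) (hn : (3 <= n)%N) :
  [forall e in wheel_edges n, (#|e| == 2)%N && (e \subset [set: 'I_n.+1])].
Proof.
apply/forall_inP => e; rewrite subsetT andbT inE.
case/orP => /imsetP[i _ ->]; rewrite cards2; apply/eqP; congr (_.+1);
  apply/eqP; rewrite eqb1 -val_eqE /=.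
  apply/eqP => ei; have lti := ltn_ord i.
  case: (ltnP i.+1 n) => h; first by move: ei; rewrite modn_small // => /eqP; rewrite ltn_eqF.
  have e1 : i.+1 = n by apply/eqP; rewrite eqn_leq lti.
  by move: ei; rewrite e1 modnn => i0; move: hn; rewrite -e1 i0.
by rewrite neq_ltn ltn_ord.
Qed.

Definition wheel (n : nat) (hn : (3 <= n)%N) : graph 'I_n.+1 :=
  Graph (wheel_edgesP hn).

(* Main.v *)
Require Import Defs.
From mathcomp Require Import all_boot all_order all_algebra.
From mathcomp.multinomials Require Import mpoly.
From mathcomp Require Import zify.

(** Put s_i for the spoke at the rim vertex i and r_i for the rim edge
{i, i+1}, with indices modulo n.  A monomial in the edges has a degree at each
vertex, the exponents of its image under the edge map, and a fibre is the set
of monomials with given degrees; the toric ideal is spanned by the differences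
of two monomials of one fibre (toric_ind).

Obstruction.  Suppose that a fibre consists of two coprime monomials m1 and m2,
and that a subgraph H lacks an edge of m1 * m2.  No divisor of m1 in the edges
of H shares its degrees with another monomial of H, hence m1 has coefficient 0
in every element of I_H (two_fibre_coef0).  As the coefficient of m1 in m1 - m2
is 1, a splitting I_G1 + I_G2 is impossible as soon as some edge x outside G1
and some edge y outside G2 both divide m1 * m2 (two_fibre_split).  For even
n >= 6 every pair of edges of the wheel is of this kind, thanks to three
families of fibres (all_linked):
- s_i r_(i+1) and s_(i+2) r_i;
- s_i s_(i+1) r_j and s_j s_(j+1) r_i, with i and j at cyclic distance >= 3;
- r_0 r_2 r_4 ... and r_1 r_3 r_5 ...

Generation.  For each n >= 3 the binomials of these three families, with the
second one relaxed to disjoint triangles and the third one present for even n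
only, generate the ideal (wheel_toric_generated).  Given two coprime monomials
of one fibre, an analysis of the degrees along the rim finds a generator one of
whose terms divides one monomial and whose other term meets the other monomial;
replacing the first term by the second produces a common factor, which is
cancelled, and the total degree drops.

Splittings.  It remains to delete two edges so that each generator avoids one of
them or follows from generators that do.  For odd n the edges r_0 and r_2 serve:
s_0 s_1 r_2 - s_2 s_3 r_0, which contains both, follows from two quadrics, and
for n = 3 the quadric that contains both is the opposite of the sum of the other
two.  For n = 4 the edges s_0 and s_1 serve, since a quadric contains only
opposite spokes.  Both summands are proper, because each edge lies in a
quadric. *)

Set Implicit Arguments.
Unset Strict Implicit.
Unset Printing Implicit Defensive.

Import GRing.Theory.
Local Open Scope ring_scope.

(** * Vertex degrees and fibres *)

Section Fibres.
Variables (K : fieldType) (V : finType) (G : graph V).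
Implicit Types (m : 'X_{1..#|edges G|}) (p : edge_ring K G) (x y : 'I_#|edges G|).

Definition vdeg m (v : V) : nat :=
  (\sum_(x < #|edges G|) m x * (v \in enum_val x))%N.

Lemma vdegD m1 m2 v : vdeg (m1 + m2)%MM v = (vdeg m1 v + vdeg m2 v)%N.
Proof. by rewrite -big_split; apply: eq_bigr => x _; rewrite mnmDE mulnDl. Qed.

Lemma vdeg0 v : vdeg 0%MM v = 0%N.
Proof. by apply: big1 => x _; rewrite mnm0E. Qed.

Lemma vdegU x v : vdeg U_(x)%MM v = (v \in enum_val x).
Proof.
rewrite /vdeg (bigD1 x) //= mnm1E eqxx mul1n big1 ?addn0 // => y nyx.
by rewrite mnm1E eq_sym (negPf nyx).
Qed.

Lemma vdegMn m k v : vdeg (m *+ k)%MM v = (vdeg m v * k)%N.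
Proof.
by rewrite big_distrl; apply: eq_bigr => x _; rewrite mulmnE /= mulnAC.
Qed.

Lemma vdeg_sum (I : Type) (r : seq I) (F : I -> 'X_{1..#|edges G|}) v :
  vdeg (\sum_(i <- r) F i)%MM v = (\sum_(i <- r) vdeg (F i) v)%N.
Proof.
by apply: (big_morph (vdeg^~ v)) => [m1 m2|]; rewrite ?vdegD ?vdeg0.
Qed.

Lemma vdegB m1 m2 v : (m1 <= m2)%MM ->
  vdeg (m2 - m1)%MM v = (vdeg m2 v - vdeg m1 v)%N.
Proof. by move=> le12; rewrite -{2}(submK le12) vdegD addnK. Qed.

Lemma edge_mem x v : v \in enum_val x -> v \in verts G.
Proof.
have /forall_inP/(_ _ (enum_valP x))/andP[_ /subsetP sx] := edgesP G.
exact: sx.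
Qed.

Lemma card_edge x : #|enum_val x| = 2%N.
Proof. by have /forall_inP/(_ _ (enum_valP x))/andP[/eqP] := edgesP G. Qed.

Lemma edge_end x : exists v, v \in enum_val x.
Proof. by apply/card_gt0P; rewrite card_edge. Qed.

Lemma leq_vdeg m x v : v \in enum_val x -> (m x <= vdeg m v)%N.
Proof. by move=> vx; rewrite /vdeg (bigD1 x) //= vx muln1 leq_addr. Qed.

Lemma vdeg_eq0 m : (forall v, vdeg m v = 0%N) -> m = 0%MM.
Proof.
move=> m0; apply/mnmP => x; rewrite mnm0E; apply/eqP; rewrite -leqn0.
by have [v vx] := edge_end x; rewrite -(m0 v) leq_vdeg.
Qed.

(** Fibres are antichains for divisibility: the quotient has degree 0 at every
vertex, and an edge contributes to the degrees of its ends. *)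
Lemma vdeg_le_eq m1 m2 : (m1 <= m2)%MM -> vdeg m1 =1 vdeg m2 -> m1 = m2.
Proof.
move=> le12 e12; have z : (m2 - m1)%MM = 0%MM.
  by apply: vdeg_eq0 => v; rewrite vdegB // e12 subnn.
by rewrite -[RHS](submK le12) z add0m.
Qed.

Lemma vdeg_out m v : v \notin verts G -> vdeg m v = 0%N.
Proof.
move=> nv; apply: big1 => x _; case vx: (v \in _); last by rewrite muln0.
by rewrite (edge_mem vx) in nv.
Qed.

(** The edge map only records degrees at vertices of G, but the other
degrees vanish. *)
Lemma eq_vdeg_mon m m' :
  ([multinom vdeg m (enum_val j) | j < #|verts G|]
     == [multinom vdeg m' (enum_val j) | j < #|verts G|]) ->
  vdeg m =1 vdeg m'.
Proof.
move=> /eqP/mnmP e v; case: (boolP (v \in verts G)) => [vG|nv]; last first.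
  by rewrite !vdeg_out.
by have := e (enum_rank_in vG v); rewrite !mnmE enum_rankK_in.
Qed.

Lemma edge_mapX m : edge_map 'X_[m] =
  'X_[[multinom vdeg m (enum_val j) | j < #|verts G|]] :> vertex_ring K G.
Proof.
rewrite /edge_map comp_mpolyX.
under eq_bigr do rewrite tnth_mktuple /edge_monomial mprodXE mpolyXn.
rewrite mprodXE; congr 'X_[_]; apply/mnmP => j.
rewrite mnm_sumE !mnmE; apply: eq_bigr => x _.
rewrite mulmnE mulnC mnm_sumE; congr (_ * _)%N.
case vx: (_ \in _); last first.
  by apply: big1 => k kx; rewrite mnm1E; case: eqP kx => // ->; rewrite vx.
rewrite (bigD1 j) //= mnm1E eqxx big1 // => k /andP[_ nkj].
by rewrite mnm1E (negPf nkj).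
Qed.

Lemma edge_mapD p q : edge_map (p + q) = edge_map p + edge_map q.
Proof. exact: comp_mpolyD. Qed.
Lemma edge_mapZ c p : edge_map (c *: p) = c *: edge_map p.
Proof. exact: comp_mpolyZ. Qed.
Lemma edge_mapM p q : edge_map (p * q) = edge_map p * edge_map q.
Proof. exact: (rmorphM (comp_mpoly _)). Qed.

Lemma toric0 : toric_ideal (0 : edge_ring K G).
Proof. exact: comp_mpoly0. Qed.

Lemma toricD p q : toric_ideal p -> toric_ideal q -> toric_ideal (p + q).
Proof. by rewrite /toric_ideal edge_mapD => -> ->; rewrite addr0. Qed.

Lemma toricZ c p : toric_ideal p -> toric_ideal (c *: p).
Proof. by rewrite /toric_ideal edge_mapZ => ->; rewrite scaler0. Qed.

Lemma toricMl a p : toric_ideal p -> toric_ideal (a * p).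
Proof. by rewrite /toric_ideal edge_mapM => ->; rewrite mulr0. Qed.

Lemma toric_binomial m m' : vdeg m =1 vdeg m' ->
  toric_ideal ('X_[m] - 'X_[m'] : edge_ring K G).
Proof.
move=> e; rewrite /toric_ideal /edge_map comp_mpolyB -!/(edge_map _) !edge_mapX.
apply/eqP; rewrite subr_eq0; apply/eqP; congr 'X_[_].
by apply/mnmP => j; rewrite !mnmE e.
Qed.

(** If m were alone in its fibre within the support of p, its coefficient would
survive as the coefficient of the image of m in the image of p. *)
Lemma toric_partner p m : toric_ideal p -> m \in msupp p ->
  exists m', [/\ m' \in msupp p, m' != m & vdeg m' =1 vdeg m].
Proof.
move=> pI mp.
have [/existsP[i /andP[ne /eq_vdeg_mon e]]|] := boolP [exists i : 'I_(size (msupp p)),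
    (nth m (msupp p) i != m) &&
    ([multinom vdeg (nth m (msupp p) i) (enum_val j) | j < #|verts G|]
     == [multinom vdeg m (enum_val j) | j < #|verts G|])].
  by exists (nth m (msupp p) i); rewrite mem_nth.
rewrite negb_exists => /forallP h; exfalso.
move: pI; rewrite /toric_ideal {1}[p]mpolyE /edge_map raddf_sum /=.
move/(congr1 (mcoeff [multinom vdeg m (enum_val j) | j < #|verts G|])).
rewrite mcoeff0 raddf_sum /= (bigD1_seq m) ?msupp_uniq //= big1_seq.
  move/eqP; rewrite addr0 comp_mpolyZ -/(edge_map _) edge_mapX mcoeffZ mcoeffX.
  by rewrite eqxx mulr1 -[_ == 0]negbK -mcoeff_msupp mp.
move=> m' /andP[ne m'p].
rewrite comp_mpolyZ -/(edge_map _) edge_mapX mcoeffZ mcoeffX.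
have lt : (index m' (msupp p) < size (msupp p))%N by rewrite index_mem.
have := h (Ordinal lt); rewrite /= nth_index // ne /=.
by move=> /negPf ->; rewrite mulr0.
Qed.

(** This is the spanning of the toric ideal by binomials in the form of an
induction principle.  Only monomials of the support of p occur in the binomials,
so that properties of the support, such as lying in a subgraph, carry over to
them. *)
Lemma toric_ind (J : edge_ring K G -> Prop) p :
  J 0 -> (forall q r, J q -> J r -> J (q + r)) ->
  toric_ideal p ->
  (forall c m m', m \in msupp p -> m' \in msupp p -> vdeg m =1 vdeg m' ->
     J (c *: ('X_[m] - 'X_[m']))) -> J p.
Proof.
move=> J0 JD.
have [k] := ubnP (size (msupp p)); elim: k p => // k IH p ltk pI Jb.
have [/eqP|ne] := boolP (msupp p == [::]); first by move/msuppnil0 ->.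
have [m mp] : exists m, m \in msupp p.
  by case: (msupp p) ne => // m s _; exists m; rewrite mem_head.
have [m' [m'p nm e]] := toric_partner pI mp.
pose b : edge_ring K G := p@_m *: ('X_[m] - 'X_[m']).
(* Subtracting b removes m from the support and only changes the coefficient of
   m', which is in the support already. *)
have bI : toric_ideal b by apply/toricZ/toric_binomial => v; rewrite e.
have sub : {subset msupp (p - b) <= msupp p}.
  move=> l; rewrite !mcoeff_msupp mcoeffB mcoeffZ mcoeffB !mcoeffX.
  have [<-|_] := eqVneq m l.
    by rewrite -mcoeff_msupp.
  have [<-|_] := eqVneq m' l.
    by rewrite -[in X in _ -> X]mcoeff_msupp.
  by rewrite subrr mulr0 subr0.
have nmb : m \notin msupp (p - b).
  rewrite mcoeff_msupp negbK mcoeffB mcoeffZ mcoeffB !mcoeffX eqxx (negPf nm).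
  by rewrite subr0 mulr1 subrr.
have -> : p = (p - b) + b by rewrite subrK.
apply: JD; last by apply: Jb => // v; rewrite e.
apply: IH.
- rewrite -ltnS; apply: leq_trans ltk; rewrite ltnS.
  rewrite (perm_size (perm_to_rem mp)) /= ltnS.
  apply: uniq_leq_size; first exact: msupp_uniq.
  move=> l lb; rewrite mem_rem_uniq ?msupp_uniq // inE sub // andbT.
  by apply: contraNneq nmb => <-.
- by rewrite -scaleN1r; apply: toricD => //; apply: toricZ.
- by move=> c l l' lp l'p; apply: Jb; apply: sub.
Qed.

End Fibres.
Arguments toric_ind {K V G} J p.

(** * Ideals of subgraphs inside the ideal of the graph *)

Section Subgraphs.
Variables (K : fieldType) (V : finType) (H G : graph V) (sHG : subgraph H G).
Implicit Types (m w : 'X_{1..#|edges G|}) (p : edge_ring K G).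

Definition edge_emb (i : 'I_#|edges H|) : 'I_#|edges G| :=
  enum_rank_in (subgraph_edge sHG i) (enum_val i).

Lemma edge_embK i : enum_val (edge_emb i) = enum_val i.
Proof. exact: enum_rankK_in (subgraph_edge sHG i). Qed.

Lemma edge_emb_inj : injective edge_emb.
Proof. by move=> i j /(congr1 enum_val); rewrite !edge_embK => /enum_val_inj. Qed.

Definition mon_emb (m : 'X_{1..#|edges H|}) : 'X_{1..#|edges G|} :=
  (\sum_(i < #|edges H|) U_(edge_emb i) *+ m i)%MM.

Lemma edge_inclX (m : 'X_{1..#|edges H|}) :
  edge_incl sHG 'X_[m] = 'X_[mon_emb m] :> edge_ring K G.
Proof.
rewrite /edge_incl comp_mpolyX.
by under eq_bigr do rewrite tnth_mktuple; rewrite mprodXnE.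
Qed.

Lemma vdeg_mon_emb (m : 'X_{1..#|edges H|}) v : vdeg (mon_emb m) v = vdeg m v.
Proof.
rewrite vdeg_sum; apply: eq_bigr => i _.
by rewrite vdegMn vdegU edge_embK mulnC.
Qed.

Definition supported m := forall x, (0 < m x)%N -> enum_val x \in edges H.

Lemma supported_emb (m : 'X_{1..#|edges H|}) : supported (mon_emb m).
Proof.
move=> x; rewrite mnm_sumE lt0n sum_nat_eq0 negb_forall => /existsP[i] /=.
rewrite mulmnE mnm1E; have [<- _|] := eqVneq (edge_emb i) x; last by rewrite mul0n.
by rewrite edge_embK; apply: enum_valP.
Qed.

(** This inverts mon_emb on the monomials supported in H. *)
Definition mon_res m : 'X_{1..#|edges H|} :=
  [multinom m (edge_emb i) | i < #|edges H|].

Lemma mon_resK m : supported m -> mon_emb (mon_res m) = m.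
Proof.
move=> sm; apply/mnmP => x; rewrite mnm_sumE.
have [mx|mx] := posnP (m x).
  rewrite mx; apply: big1 => i _; rewrite mulmnE mnm1E mnmE.
  by case: eqP => [->|_]; rewrite ?mx.
have xH := sm x mx; pose i := enum_rank_in xH (enum_val x).
have ix : edge_emb i = x.
  by apply: enum_val_inj; rewrite edge_embK enum_rankK_in.
rewrite (bigD1 i) //= mulmnE mnm1E mnmE ix eqxx mul1n big1 ?addn0 // => j nji.
rewrite mulmnE mnm1E -ix; case: eqP => // /edge_emb_inj ji.
by rewrite ji eqxx in nji.
Qed.

Lemma edge_inclD (q r : edge_ring K H) :
  edge_incl sHG (q + r) = edge_incl sHG q + edge_incl sHG r.
Proof. exact: comp_mpolyD. Qed.

Lemma edge_incl_binomial c (m m' : 'X_{1..#|edges H|}) :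
  edge_incl sHG (c *: ('X_[m] - 'X_[m']))
    = c *: ('X_[mon_emb m] - 'X_[mon_emb m']) :> edge_ring K G.
Proof. by rewrite /edge_incl comp_mpolyZ comp_mpolyB -!/(edge_incl _ _) !edge_inclX. Qed.

Lemma edge_incl_toric (q : edge_ring K H) : toric_ideal q ->
  toric_ideal (edge_incl sHG q).
Proof.
pose J (r : edge_ring K H) := toric_ideal (edge_incl sHG r).
move=> qI; apply: (toric_ind J q _ _ qI).
- by rewrite /J /edge_incl comp_mpoly0; apply: toric0.
- by move=> a b; rewrite /J edge_inclD; exact: toricD.
move=> c m m' _ _ e; rewrite /J edge_incl_binomial.
by apply/toricZ/toric_binomial => v; rewrite !vdeg_mon_emb.
Qed.

Lemma edge_incl_supported (q : edge_ring K H) m :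
  m \in msupp (edge_incl sHG q) -> supported m.
Proof.
rewrite {1}[q]mpolyE /edge_incl raddf_sum /= => /msupp_sum_le/flatten_mapP[l _].
rewrite comp_mpolyZ -/(edge_incl _ _) => /msuppZ_le.
by rewrite edge_inclX msuppX inE => /eqP ->; apply: supported_emb.
Qed.

Lemma ext_toric_sub p : ext_toric_ideal sHG p -> toric_ideal p.
Proof.
case=> k [a [s [Is ->]]]; elim/big_ind: _ => [||i _].
- exact: toric0.
- exact: toricD.
- by apply: toricMl; have [q Iq ->] := Is i; apply: edge_incl_toric.
Qed.

Lemma ext_toric0 : ext_toric_ideal sHG (0 : edge_ring K G).
Proof. by exists 0%N, (fun=> 0), (fun=> 0); split=> [[]|]; rewrite ?big_ord0. Qed.

Lemma ext_toricD p q : ext_toric_ideal sHG p -> ext_toric_ideal sHG q ->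
  ext_toric_ideal sHG (p + q).
Proof.
case=> k [a [s [Is ->]]] [l [b [t [It ->]]]].
exists (k + l)%N, (fun i => match split i with inl j => a j | inr j => b j end),
  (fun i => match split i with inl j => s j | inr j => t j end).
split=> [i|]; first by case: split.
rewrite big_split_ord /=; congr (_ + _); apply: eq_bigr => i _.
  by case: split_ordP (@split_ordP _ _ (lshift l i)) => j /eqP; 
     rewrite ?eq_lshift ?eq_lrshift // => /eqP ->.
by case: split_ordP (@split_ordP _ _ (rshift k i)) => j /eqP; 
     rewrite ?eq_rshift ?eq_rlshift // => /eqP ->.
Qed.

Lemma ext_toricMl a p : ext_toric_ideal sHG p -> ext_toric_ideal sHG (a * p).
Proof.
case=> k [b [s [Is ->]]]; exists k, (fun i => a * b i), s; split=> //.
by rewrite mulr_sumr; apply: eq_bigr => i _; rewrite mulrA.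
Qed.

(** Each binomial that spans p is already a binomial of H, as degrees do not
depend on the ambient graph. *)
Lemma ext_toric_supported p : toric_ideal p ->
  (forall m, m \in msupp p -> supported m) -> ext_toric_ideal sHG p.
Proof.
move=> pI sp; apply: (toric_ind _ p ext_toric0 ext_toricD pI).
move=> c m m' mp m'p e.
exists 1%N, (fun=> c%:MP), (fun=> 'X_[m] - 'X_[m']); split=> [_|]; last first.
  by rewrite big_ord1 mul_mpolyC.
exists ('X_[mon_res m] - 'X_[mon_res m']).
  apply: toric_binomial => v.
  by rewrite -!vdeg_mon_emb !mon_resK ?e //; apply: sp.
by rewrite /edge_incl comp_mpolyB -!/(edge_incl _ _) !edge_inclX !mon_resK //;
  apply: sp.
Qed.

Lemma ext_toric_binomial m m' : vdeg m =1 vdeg m' ->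
  supported m -> supported m' ->
  ext_toric_ideal sHG ('X_[m] - 'X_[m'] : edge_ring K G).
Proof.
move=> e sm sm'; apply: ext_toric_supported; first exact: toric_binomial.
by move=> l /msuppB_le; rewrite !msuppX mem_cat !inE => /orP[]/eqP->.
Qed.

(** In a multiple of an element q of I_H, the coefficient of m only involves
coefficients of q at divisors w of m; such a w would need a partner of the same
degrees in the support of q. *)
Lemma ext_toric_coef0 m p :
  (forall w w', (w <= m)%MM -> supported w -> supported w' ->
     vdeg w =1 vdeg w' -> w' = w) ->
  ext_toric_ideal sHG p -> p@_m = 0.
Proof.
move=> lone [k [a [s [Is ->]]]]; rewrite raddf_sum /=; apply: big1 => i _.
have [q Iq ->] := Is i; rewrite mcoeffM; apply: big1 => -[w1 w2] /= /eqP mw.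
have [wq|/memN_msupp_eq0 ->] := boolP (bmnm w2 \in msupp (edge_incl sHG q));
  last by rewrite mulr0.
have [w' [w'q ne e]] := toric_partner (edge_incl_toric Iq) wq.
case/eqP: ne; apply: lone => [||| v]; rewrite ?e //.
- by apply/mnm_lepP => x; move/mnmP/(_ x): mw ->; rewrite mnmDE leq_addl.
- exact: edge_incl_supported wq.
- exact: edge_incl_supported w'q.
Qed.

(** If H had all the edges of G, every monomial of G would be supported in H. *)
Lemma ext_toric_missing_edge :
  ~ ideal_eq (ext_toric_ideal sHG) (@toric_ideal K V G) ->
  exists x : 'I_#|edges G|, enum_val x \notin edges H.
Proof.
move=> ne; apply/existsP; apply: contraT; rewrite negb_exists => /forallP all.
case: ne => p; split; first exact: ext_toric_sub.
move=> pI; apply: ext_toric_supported => // m _ x _.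
by have := all x; rewrite negbK.
Qed.

End Subgraphs.
(** * Fibres with two elements *)

Section TwoElementFibres.
Variables (K : fieldType) (V : finType) (G : graph V).
Implicit Types (m w : 'X_{1..#|edges G|}) (x y : 'I_#|edges G|).

(** The third condition asks for divisibility only; by vdeg_le_eq it makes m
equal to m1 or to m2. *)
Definition two_fibre m1 m2 :=
  [/\ vdeg m1 =1 vdeg m2, (forall x, m1 x = 0 \/ m2 x = 0)%N
    & forall m, vdeg m =1 vdeg m1 -> (m1 <= m)%MM \/ (m2 <= m)%MM].

(** If w divides m1 and w' has the degrees of w, then w' * (m1 / w) lies in the
fibre, so it is m1, and w' = w, or m2.  In the latter case m1 / w divides both
m1 and m2, so w = m1 and w' = m2, and H contains every edge of m1 * m2. *)
Lemma two_fibre_coef0 (H : graph V) (sHG : subgraph H G) m1 m2 x p :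
  two_fibre m1 m2 -> (0 < m1 x + m2 x)%N -> enum_val x \notin edges H ->
  ext_toric_ideal sHG p -> (p : edge_ring K G)@_m1 = 0.
Proof.
move=> [e12 dis fib] mx xH; apply: ext_toric_coef0 => w w' lew sw sw' eww.
have eadd : vdeg (w' + (m1 - w))%MM =1 vdeg m1.
  by move=> v; rewrite vdegD -eww -{2}(submK lew) vdegD addnC.
case: (fib _ eadd) => le.
  have /esym := vdeg_le_eq le (fsym eadd); rewrite -{2}(submK lew) addmC.
  by move/addmI.
have /mnmP e2 := vdeg_le_eq le (ftrans (fsym e12) (fsym eadd)).
have nx : (m1 x <= w x)%N /\ (m2 x <= w' x)%N.
  by have := e2 x; have := dis x; rewrite mnmDE mnmBE; lia.
by have := @sw x; have := @sw' x; rewrite (negPf xH); lia.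
Qed.

(** The coefficient of m1 is 1 in m1 - m2, but 0 in both ideals if neither
subgraph contains the respective edge. *)
Lemma two_fibre_split (G1 G2 : graph V) (s1 : subgraph G1 G)
    (s2 : subgraph G2 G) m1 m2 x y :
  ideal_eq (@toric_ideal K V G)
    (ideal_add (ext_toric_ideal s1) (ext_toric_ideal s2)) ->
  two_fibre m1 m2 -> (0 < m1 x + m2 x)%N -> (0 < m1 y + m2 y)%N ->
  enum_val x \in edges G1 \/ enum_val y \in edges G2.
Proof.
move=> eI tf mx my.
have [|x1] := boolP (enum_val x \in edges G1); first by left.
have [|y2] := boolP (enum_val y \in edges G2); first by right.
have [e12 dis _] := tf.
have /eI[a [b [I1 I2 /(congr1 (mcoeff m1))]]] := toric_binomial K e12.
rewrite mcoeffB [RHS]mcoeffD.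
rewrite (two_fibre_coef0 tf mx x1 I1) (two_fibre_coef0 tf my y2 I2) !mcoeffX.
rewrite eqxx addr0; case: eqP => [e|_].
  by have := dis x; move: mx; rewrite e; lia.
by move/eqP; rewrite subr0 oner_eq0.
Qed.

(** Without the edge x, the divisors of x * y that remain in H are 1 and y, and
each of them is determined by its degrees.  Fibres of size three, as they occur
in the wheel with three spokes, are covered as well. *)
Lemma quadric_coef0 (H : graph V) (sHG : subgraph H G) x y p :
  enum_val x \notin edges H -> ext_toric_ideal sHG p ->
  (p : edge_ring K G)@_(U_(x) + U_(y)) = 0.
Proof.
move=> xH; apply: ext_toric_coef0 => w w' /mnm_lepP lew sw _ eww.
have wx : w x = 0%N.
  by have := @sw x; rewrite (negPf xH); case: (w x) => // k; move/(_ isT).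
have wy z : (w z <= (y == z))%N.
  have := lew z; rewrite mnmDE !mnm1E.
  by have [<-|] := eqVneq x z; first rewrite wx.
have [wy0|wy0] := posnP (w y).
  have w0 : w = 0%MM.
    apply/mnmP => z; rewrite mnm0E; have := wy z.
    by have [<-|_] := eqVneq y z; rewrite ?wy0 // leqn0 => /eqP.
  by rewrite w0; apply: vdeg_eq0 => v; rewrite -eww w0 vdeg0.
have wU : w = U_(y)%MM.
  apply/mnmP => z; rewrite mnm1E; have := wy z.
  by have [<-|_] := eqVneq y z; lia.
rewrite wU in eww *.
have [w0|ne] := eqVneq w' 0%MM.
  have [v vy] := edge_end y.
  by have := eww v; rewrite w0 vdeg0 vdegU vy.
have [z wz] : exists z, (0 < w' z)%N.
  apply/existsP; apply: contraNT ne; rewrite negb_exists => /forallP all.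
  by apply/eqP/mnmP => z; rewrite mnm0E; have := all z; rewrite lt0n negbK => /eqP.
have zy : z = y.
  apply: enum_val_inj; apply/eqP; rewrite eqEcard !card_edge leqnn andbT.
  apply/subsetP => v vz; have := leq_trans wz (leq_vdeg w' vz).
  by rewrite -eww vdegU; case: (v \in _).
apply/esym/vdeg_le_eq => //; apply/mnm_lepP => t; rewrite mnm1E -zy.
by have [<-|] := eqVneq z t.
Qed.

Lemma del_edgeP x : [forall e in edges G :\ enum_val x,
  (#|e| == 2)%N && (e \subset verts G)].
Proof.
apply/forall_inP => e /setD1P[_ eG].
by have /forall_inP/(_ _ eG) := edgesP G.
Qed.

Definition del_edge x : graph V := Graph (del_edgeP x).

Lemma del_edge_sub x : subgraph (del_edge x) G.
Proof. by rewrite /subgraph subxx /= subD1set. Qed.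

Lemma supported_del x m : m x = 0%N -> supported (del_edge x) m.
Proof.
move=> mx y my; rewrite !inE (enum_valP y) andbT (inj_eq enum_val_inj).
by apply: contraTneq my => ->; rewrite mx.
Qed.

End TwoElementFibres.

(** * Square-free monomials *)

Section SquareFree.
Variables (V : finType) (G : graph V).
Implicit Types (m : 'X_{1..#|edges G|}) (x y : 'I_#|edges G|).

Definition sqf (l : seq 'I_#|edges G|) : 'X_{1..#|edges G|} :=
  (\sum_(x <- l) U_(x))%MM.

Lemma sqfE l x : sqf l x = count_mem x l.
Proof.
rewrite mnm_sumE -sum1_count [RHS]big_mkcond /=.
by apply: eq_bigr => y _; rewrite mnm1E; case: eqP.
Qed.

Lemma sqf_gt0 l x : (0 < sqf l x)%N = (x \in l).
Proof. by rewrite sqfE -has_count has_pred1. Qed.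

Lemma vdeg_sqf l v : vdeg (sqf l) v = (\sum_(x <- l) (v \in enum_val x))%N.
Proof. by rewrite vdeg_sum; apply: eq_bigr => x _; rewrite vdegU. Qed.

Lemma sqf_le l m : uniq l -> {in l, forall x, 0 < m x}%N -> (sqf l <= m)%MM.
Proof.
move=> ul ml; apply/mnm_lepP => x; rewrite sqfE count_uniq_mem //.
by case: (boolP (x \in l)) => // /ml.
Qed.

Lemma sqf_two_fibre l1 l2 : vdeg (sqf l1) =1 vdeg (sqf l2) ->
  uniq l1 -> uniq l2 -> ~~ has (mem l1) l2 ->
  (forall m, vdeg m =1 vdeg (sqf l1) ->
     {in l1, forall x, 0 < m x}%N \/ {in l2, forall x, 0 < m x}%N) ->
  two_fibre (sqf l1) (sqf l2).
Proof.
move=> e12 u1 u2 /hasPn dis fib; split=> // [x|m /fib[]h].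
- have [/dis nx|nx] := boolP (x \in l2).
    by left; apply/eqP; rewrite -leqn0 leqNgt sqf_gt0.
  by right; apply/eqP; rewrite -leqn0 leqNgt sqf_gt0.
- by left; apply: sqf_le.
- by right; apply: sqf_le.
Qed.

End SquareFree.

(** * Edges of the wheel *)

Section Wheel.
Variables (n : nat) (hn : (3 <= n)%N).
Let W := wheel hn.
Implicit Types (i j k : 'I_n) (m : 'X_{1..#|edges W|}).

Lemma spoke_proof i : [set rim i; ord_max] \in edges W.
Proof. by rewrite inE; apply/orP; right; apply: imset_f. Qed.
Lemma rim_edge_proof i : [set rim i; rim (ordS i)] \in edges W.
Proof. by rewrite inE; apply/orP; left; apply: imset_f. Qed.

Definition spoke i : 'I_#|edges W| :=
  enum_rank_in (spoke_proof i) [set rim i; ord_max].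
Definition rim_edge i : 'I_#|edges W| :=
  enum_rank_in (rim_edge_proof i) [set rim i; rim (ordS i)].

Lemma spokeE i : enum_val (spoke i) = [set rim i; ord_max].
Proof. exact: enum_rankK_in (spoke_proof i). Qed.
Lemma rim_edgeE i : enum_val (rim_edge i) = [set rim i; rim (ordS i)].
Proof. exact: enum_rankK_in (rim_edge_proof i). Qed.

Lemma wheel_edge_cases x :
  (exists i, x = spoke i) \/ (exists i, x = rim_edge i).
Proof.
have := enum_valP x; rewrite inE => /orP[]/imsetP[i _ xi].
  by right; exists i; apply: enum_val_inj; rewrite rim_edgeE.
by left; exists i; apply: enum_val_inj; rewrite spokeE.
Qed.

Lemma rim_eq i j : (rim i == rim j) = (i == j).
Proof. by rewrite -!val_eqE. Qed.

Lemma rim_hub i : (rim i == ord_max) = false.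
Proof. by rewrite -val_eqE /= ltn_eqF. Qed.

Lemma vertex_cases (v : 'I_n.+1) : v = ord_max \/ exists i, v = rim i.
Proof.
case: (unliftP ord_max v) => [i ->|->]; last by left.
right; exists i; apply: val_inj; rewrite /= /bump leqNgt ltn_ord.
by [].
Qed.

(** Cyclic positions are written as natural offsets from a base vertex i, so
that arithmetic on offsets below n decides which of them coincide. *)
Definition shift i a := iter a (@ordS n) i.

Lemma val_shift i a : shift i a = ((i + a) %% n)%N :> nat.
Proof.
elim: a => [|a IH]; first by rewrite addn0 modn_small.
by rewrite /= IH addnS -addn1 modnDml addn1.
Qed.

Lemma shift_eq i a b : (shift i a == shift i b) = (a == b %[mod n])%N.
Proof. by rewrite -val_eqE /= !val_shift eqn_modDl. Qed.

Lemma shift_n i : shift i n = i.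
Proof. by apply/eqP; rewrite -[eqbRHS](erefl : shift i 0 = i) shift_eq modnn mod0n. Qed.

Lemma shift_ex i j : exists2 a, (a < n)%N & j = shift i a.
Proof.
exists ((j + (n - i)) %% n)%N; first by rewrite ltn_mod; lia.
apply: val_inj; rewrite /= val_shift modnDmr.
have -> : (i + (j + (n - i)) = j + n)%N by have := ltn_ord i; lia.
by rewrite modnDr modn_small.
Qed.

Lemma shift_neq i a b : (a < n)%N -> (b < n)%N -> a != b ->
  (shift i a == shift i b) = false.
Proof. by move=> la lb ne; rewrite shift_eq !modn_small // (negPf ne). Qed.

Lemma shift_eqE i a b : (a < n)%N -> (b < n)%N ->
  (shift i a == shift i b) = (a == b).
Proof. by move=> la lb; rewrite shift_eq !modn_small. Qed.

Lemma ordS_neq i : (i == ordS i) = false.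
Proof. by apply: (@shift_neq i 0 1); lia. Qed.

Lemma ordS_neqC i : (ordS i == i) = false.
Proof. by rewrite eq_sym ordS_neq. Qed.

Lemma ordSS_neq i : (i == ordS (ordS i)) = false.
Proof. by apply: (@shift_neq i 0 2); lia. Qed.

Lemma ordSS_neqC i : (ordS (ordS i) == i) = false.
Proof. by rewrite eq_sym ordSS_neq. Qed.

Lemma mem_rim_edge k i :
  (rim k \in enum_val (rim_edge i)) = ((k == i) + (k == ordS i))%N :> nat.
Proof.
rewrite rim_edgeE !inE !rim_eq; have [->|_] := eqVneq k i => //=.
by rewrite ordS_neq.
Qed.

Lemma mem_spoke k i : (rim k \in enum_val (spoke i)) = (k == i).
Proof. by rewrite spokeE !inE rim_eq rim_hub orbF. Qed.

Lemma hub_spoke i : ord_max \in enum_val (spoke i).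
Proof. by rewrite spokeE !inE eqxx orbT. Qed.

Lemma hub_rim_edge i : (ord_max \in enum_val (rim_edge i)) = false.
Proof. by rewrite rim_edgeE !inE ![ord_max == _]eq_sym !rim_hub. Qed.

Lemma spoke_eq i j : (spoke i == spoke j) = (i == j).
Proof.
apply/eqP/eqP => [e|-> //]; apply/eqP.
by rewrite -mem_spoke -e mem_spoke.
Qed.

Lemma spoke_rim_edge i j : (spoke i == rim_edge j) = false.
Proof. by apply/eqP => e; have := hub_spoke i; rewrite e hub_rim_edge. Qed.

Lemma rim_edge_spoke i j : (rim_edge i == spoke j) = false.
Proof. by rewrite eq_sym spoke_rim_edge. Qed.

(** This needs n >= 3: in a cycle of length two, both edges would have the same
ends. *)
Lemma rim_edge_eq i j : (rim_edge i == rim_edge j) = (i == j).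
Proof.
apply/eqP/eqP => [e|-> //]; apply/eqP; apply: contraT => ne.
have := mem_rim_edge i i; have := mem_rim_edge (ordS i) i.
rewrite e !mem_rim_edge (negPf ne) !eqxx; have [->|_] := eqVneq i (ordS j).
  have -> : (ordS (ordS j) == j) = false by apply: (@shift_neq j 2 0); lia.
  have -> : (ordS (ordS j) == ordS j) = false by apply: (@shift_neq j 2 1); lia.
  by rewrite addn1.
by rewrite add1n.
Qed.

Lemma sum_wheel (F : 'I_#|edges W| -> nat) :
  (\sum_x F x = \sum_i F (spoke i) + \sum_i F (rim_edge i))%N.
Proof.
rewrite (bigID (mem (spoke @: setT))) /=; congr addn.
  rewrite big_imset /= => [|i j _ _ /eqP]; last by rewrite spoke_eq => /eqP.
  by apply: eq_bigl => i; rewrite inE.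
rewrite (eq_bigl (mem (rim_edge @: setT))) => [|x].
  rewrite big_imset /= => [|i j _ _ /eqP]; last by rewrite rim_edge_eq => /eqP.
  by apply: eq_bigl => i; rewrite inE.
case: (wheel_edge_cases x) => -[i ->].
  rewrite imset_f //=; apply/esym/negbTE/imsetP => -[j _ /eqP].
  by rewrite spoke_rim_edge.
rewrite /= [RHS]imset_f //; apply/imsetP => -[j _ /eqP].
by rewrite rim_edge_spoke.
Qed.

Lemma vdeg_hub m : vdeg m ord_max = (\sum_i m (spoke i))%N.
Proof.
rewrite /vdeg sum_wheel [X in (_ + X)%N]big1 => [|i _]; last first.
  by rewrite hub_rim_edge muln0.
by rewrite addn0; apply: eq_bigr => i _; rewrite hub_spoke muln1.
Qed.

Lemma vdeg_rim m i : vdeg m (rim (ordS i)) =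
  (m (spoke (ordS i)) + m (rim_edge i) + m (rim_edge (ordS i)))%N.
Proof.
rewrite /vdeg sum_wheel -addnA; congr addn.
  rewrite (bigD1 (ordS i)) //= mem_spoke eqxx muln1 big1 ?addn0 // => j nj.
  by rewrite mem_spoke eq_sym (negPf nj) muln0.
under eq_bigr do rewrite mem_rim_edge.
have nSi : (ordS i == i) = false by rewrite eq_sym ordS_neq.
rewrite (bigD1 i) //= (bigD1 (ordS i)) ?nSi //= eqxx ordS_neq.
rewrite !muln1 big1 ?addn0 // => j /andP[ni nj].
by rewrite eq_sym (negPf nj) (inj_eq (@ordS_inj n)) eq_sym (negPf ni) muln0.
Qed.

(** * Quadrics, triangle pairs and the rim *)

Definition quad_l i := sqf [:: spoke i; rim_edge (ordS i)].
Definition quad_r i := sqf [:: spoke (ordS (ordS i)); rim_edge i].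
(** The spokes of the triangle at r_i times the opposite edge r_j of the other
triangle: tri i j and tri j i are the two terms of the binomial of the closed
walk through both triangles. *)
Definition tri i j := sqf [:: spoke i; spoke (ordS i); rim_edge j].
(** For even n these are the two perfect matchings of the rim. *)
Definition rim_half (b : bool) :=
  sqf [seq rim_edge k | k <- enum 'I_n & odd k == b].

Lemma vdeg_quad_l i k : vdeg (quad_l i) (rim k) =
  ((k == i) + (k == ordS i) + (k == ordS (ordS i)))%N.
Proof. by rewrite vdeg_sqf !big_cons big_nil mem_spoke mem_rim_edge; lia. Qed.

Lemma vdeg_quad_l_hub i : vdeg (quad_l i) ord_max = 1%N.
Proof. by rewrite vdeg_sqf !big_cons big_nil hub_spoke hub_rim_edge. Qed.

Lemma quad_vdeg i : vdeg (quad_l i) =1 vdeg (quad_r i).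
Proof.
move=> v; case: (vertex_cases v) => [|[k]] ->.
  by rewrite !vdeg_sqf !big_cons big_nil !hub_spoke !hub_rim_edge.
by rewrite !vdeg_sqf !big_cons big_nil !mem_spoke !mem_rim_edge; lia.
Qed.

Lemma vdeg_tri i j k : vdeg (tri i j) (rim k) =
  ((k == i) + (k == ordS i) + (k == j) + (k == ordS j))%N.
Proof.
by rewrite vdeg_sqf !big_cons big_nil !mem_spoke mem_rim_edge; lia.
Qed.

Lemma vdeg_tri_hub i j : vdeg (tri i j) ord_max = 2%N.
Proof. by rewrite vdeg_sqf !big_cons big_nil !hub_spoke hub_rim_edge. Qed.

Lemma tri_vdeg i j : vdeg (tri i j) =1 vdeg (tri j i).
Proof.
move=> v; case: (vertex_cases v) => [|[k]] ->; rewrite ?vdeg_tri_hub //.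
by rewrite !vdeg_tri; lia.
Qed.

Lemma rim_edge_inj : injective rim_edge.
Proof. by move=> i j /eqP; rewrite rim_edge_eq => /eqP. Qed.

Lemma rim_half_uniq b : uniq [seq rim_edge k | k <- enum 'I_n & odd k == b].
Proof. by rewrite (map_inj_uniq rim_edge_inj); exact: filter_uniq (enum_uniq _). Qed.

Lemma rim_half_edge b k : rim_half b (rim_edge k) = (odd k == b).
Proof.
rewrite sqfE count_uniq_mem ?rim_half_uniq // (mem_map rim_edge_inj).
by rewrite mem_filter mem_enum andbT.
Qed.

Lemma rim_half_mem b x :
  reflect (exists2 k : 'I_n, odd k == b & x = rim_edge k)
    (x \in [seq rim_edge k | k <- enum 'I_n & odd k == b]).
Proof.
apply: (iffP mapP) => -[k]; first by rewrite mem_filter => /andP[]; exists k.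
by move=> kb ->; exists k; rewrite // mem_filter kb mem_enum.
Qed.

Lemma rim_half_spoke b k : rim_half b (spoke k) = 0%N.
Proof.
apply/eqP; rewrite -leqn0 leqNgt sqf_gt0; apply/negP => /rim_half_mem[j _ /eqP].
by rewrite spoke_rim_edge.
Qed.

(** For even n the parity is well defined modulo n. *)
Lemma odd_shift i a : ~~ odd n -> odd (shift i a) = odd i (+) odd a.
Proof. by move=> en; rewrite val_shift odd_mod ?(negPf en) // oddD. Qed.

Lemma vdeg_rim_half b v : ~~ odd n -> vdeg (rim_half b) v = (v != ord_max).
Proof.
move=> en; case: (vertex_cases v) => [|[k]] ->.
  by rewrite vdeg_hub eqxx; apply: big1 => i _; rewrite rim_half_spoke.
rewrite rim_hub -(ord_predK k) vdeg_rim rim_half_spoke !rim_half_edge.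
rewrite (odd_shift _ 1 en : odd (ordS _) = _) addbT.
by case: b; case: (odd _).
Qed.

Lemma sum_support (F : 'I_n -> nat) l :
  uniq l -> (forall k, k \notin l -> F k = 0%N) ->
  (\sum_k F k = \sum_(k <- l) F k)%N.
Proof.
move=> ul F0; rewrite (bigID (mem l)) /= [X in (_ + X)%N]big1 => [|k]; last exact: F0.
by rewrite addn0 big_uniq.
Qed.

(** Degree 0 at i-1 and i+3 kills r_(i-1) and r_(i+2).  The hub has degree 1, and
the equations at i, i+1, i+2 exclude the spoke s_(i+1), whose choice would leave
the non-adjacent vertices i and i+2 to be matched. *)
Lemma quad_two_fibre i : (4 <= n)%N -> two_fibre (quad_l i) (quad_r i).
Proof.
move=> n4.
apply: sqf_two_fibre; first exact: quad_vdeg.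
- by rewrite /= inE spoke_rim_edge.
- by rewrite /= inE spoke_rim_edge.
- by rewrite /= !inE rim_edge_eq spoke_eq spoke_rim_edge rim_edge_spoke
    ordS_neq ordSS_neqC.
move=> m em.
have D a : (a.+1 < n)%N -> (m (spoke (shift i a.+1)) + m (rim_edge (shift i a))
    + m (rim_edge (shift i a.+1)))%N = ((a.+1 == 1) + (a.+1 == 2))%N.
  move=> la; rewrite -vdeg_rim em vdeg_quad_l.
  rewrite (shift_eqE i la (_ : 0 < n)%N) ?(shift_eqE i la (_ : 1 < n)%N) //; try lia.
  by rewrite (shift_eqE i la (_ : 2 < n)%N).
have D0 : (m (spoke i) + m (rim_edge (shift i n.-1)) + m (rim_edge i))%N = 1%N.
  have e : ordS (shift i n.-1) = i.
    by rewrite -[LHS]/(shift i n.-1.+1) prednK ?shift_n //; lia.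
  by rewrite -{1 3}e -vdeg_rim em vdeg_quad_l e eqxx ordS_neq ordSS_neq.
have S0 k : k \notin [:: i; ordS i; ordS (ordS i)] -> m (spoke k) = 0%N.
  rewrite !inE => nk; apply/eqP; rewrite -leqn0.
  apply: leq_trans (leq_vdeg m (_ : rim k \in _)) _; first by rewrite mem_spoke.
  by rewrite em vdeg_quad_l; lia.
have := em ord_max; rewrite vdeg_quad_l_hub vdeg_hub (sum_support _ S0); last first.
  by rewrite /= !inE !ordS_neq ordSS_neq.
rewrite !big_cons big_nil.
have D1 : (m (spoke (ordS i)) + m (rim_edge i) + m (rim_edge (ordS i)) = 1)%N.
  by apply: (D 0%N); lia.
have D2 : (m (spoke (ordS (ordS i))) + m (rim_edge (ordS i))
    + m (rim_edge (ordS (ordS i))) = 1)%N by apply: (D 1%N); lia.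
have D3 : m (rim_edge (ordS (ordS i))) = 0%N by have := D 2 n4; rewrite /=; lia.
have Dn : m (rim_edge (shift i n.-1)) = 0%N.
  have n21 : n.-2.+1 = n.-1 by lia.
  by have := D n.-2; rewrite n21; lia.
move=> hub.
have [?|?] : (((0 < m (spoke i)) && (0 < m (rim_edge (ordS i)))) \/
   ((0 < m (spoke (ordS (ordS i)))) && (0 < m (rim_edge i))))%N by lia.
  by left => x; rewrite !inE => /orP[]/eqP->; lia.
by right => x; rewrite !inE => /orP[]/eqP->; lia.
Qed.

(** A distance of at least 3 in both directions leaves a vertex of degree 0
between the two triangles on each side, so r_i and r_j are the only rim edges
available; hub degree 2 forces exactly one of them. *)
Lemma tri_two_fibre i d : (3 <= d)%N -> (d + 3 <= n)%N ->
  two_fibre (tri i (shift i d)) (tri (shift i d) i).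
Proof.
move=> d3 dn; set j := shift i d.
have ij : (i == j) = false by apply: (@shift_neq i 0 d); lia.
have iSj : (i == ordS j) = false by apply: (@shift_neq i 0 d.+1); lia.
have Sij : (ordS i == j) = false by apply: (@shift_neq i 1 d); lia.
have SiSj : (ordS i == ordS j) = false by apply: (@shift_neq i 1 d.+1); lia.
apply: sqf_two_fibre; first exact: tri_vdeg.
- by rewrite /= !inE !spoke_eq !spoke_rim_edge ordS_neq.
- by rewrite /= !inE !spoke_eq !spoke_rim_edge ordS_neq.
- by rewrite /= !inE !spoke_eq !spoke_rim_edge !rim_edge_spoke rim_edge_eq
    ![j == _]eq_sym ![ordS j == _]eq_sym ij iSj Sij SiSj.
move=> m em.
have D a : (a.+1 < n)%N -> (m (spoke (shift i a.+1)) + m (rim_edge (shift i a))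
    + m (rim_edge (shift i a.+1)))%N
    = ((a.+1 == 1) + (a.+1 == d) + (a.+1 == d.+1))%N.
  move=> la; rewrite -vdeg_rim em vdeg_tri.
  rewrite (shift_eqE i la (_ : 0 < n)%N) ?(shift_eqE i la (_ : 1 < n)%N) //; try lia.
  rewrite (shift_eqE i la (_ : d < n)%N) ?(shift_eqE i la (_ : d.+1 < n)%N) //; lia.
have n1 : n.-1.+1 = n by lia.
have n2 : n.-2.+1 = n.-1 by lia.
have d1 : d.-1.+1 = d by lia.
have d2 : d.-2.+1 = d.-1 by lia.
have D0 : (m (spoke i) + m (rim_edge (shift i n.-1)) + m (rim_edge i))%N = 1%N.
  have e1 : ordS (shift i n.-1) = i by rewrite -[LHS]/(shift i n.-1.+1) n1 shift_n.
  by rewrite -{1 3}e1 -vdeg_rim em vdeg_tri e1 eqxx ordS_neq ij iSj.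
have S0 k : k \notin [:: i; ordS i; j; ordS j] -> m (spoke k) = 0%N.
  rewrite !inE => nk; apply/eqP; rewrite -leqn0.
  apply: leq_trans (leq_vdeg m (_ : rim k \in _)) _; first by rewrite mem_spoke.
  by rewrite em vdeg_tri; lia.
have := em ord_max; rewrite vdeg_tri_hub vdeg_hub (sum_support _ S0); last first.
  by rewrite /= !inE !ordS_neq ij iSj Sij SiSj.
rewrite !big_cons big_nil => hub.
have Rn : m (rim_edge (shift i n.-1)) = 0%N by have := D n.-2; rewrite n2; lia.
have R1 : m (rim_edge (ordS i)) = 0%N.
  by have := D 1%N; rewrite /=; lia.
have R2 : m (rim_edge (shift i d.-1)) = 0%N.
  by have := D d.-2; rewrite d2; lia.
have R3 : m (rim_edge (ordS j)) = 0%N.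
  by have := D d.+1; rewrite -[shift i d.+1]/(ordS j); lia.
have D1 : (m (spoke (ordS i)) + m (rim_edge i) + m (rim_edge (ordS i)) = 1)%N.
  by rewrite (D 0%N); lia.
have D2 : (m (spoke j) + m (rim_edge (shift i d.-1)) + m (rim_edge j) = 1)%N.
  by have := D d.-1; rewrite d1 -/j; lia.
have D3 : (m (spoke (ordS j)) + m (rim_edge j) + m (rim_edge (ordS j)) = 1)%N.
  by rewrite (D d); lia.
have [?|?] : ([&& 0 < m (spoke i), 0 < m (spoke (ordS i)) & 0 < m (rim_edge j)] \/
   [&& 0 < m (spoke j), 0 < m (spoke (ordS j)) & 0 < m (rim_edge i)])%N by lia.
  by left => x; rewrite !inE => /or3P[]/eqP->; lia.
by right => x; rewrite !inE => /or3P[]/eqP->; lia.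
Qed.

(** Degree 0 at the hub excludes spokes; then the exponents of consecutive rim
edges sum to 1, so they alternate. *)
Lemma rim_two_fibre : ~~ odd n -> two_fibre (rim_half false) (rim_half true).
Proof.
move=> en; apply: sqf_two_fibre; try exact: rim_half_uniq.
- by move=> v; rewrite !vdeg_rim_half.
- apply/hasPn => x /rim_half_mem[k ko ->]; apply/negP => /rim_half_mem[k' ke].
  by move/eqP; rewrite rim_edge_eq => /eqP kk; move: ko ke; rewrite kk => /eqP->.
move=> m em.
have s0 k : m (spoke k) = 0%N.
  by apply/eqP; rewrite -leqn0 (leq_trans (leq_vdeg m (hub_spoke k))) // em vdeg_rim_half ?eqxx.
have D k : (m (rim_edge k) + m (rim_edge (ordS k)) = 1)%N.
  by have := vdeg_rim m k; rewrite s0 em vdeg_rim_half // rim_hub.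
have n0 : (0 < n)%N by lia.
pose o := Ordinal n0.
have all k : m (rim_edge k) = (if odd k then 1 - m (rim_edge o) else m (rim_edge o))%N.
  have [a _ ->] := shift_ex o k; rewrite odd_shift //=.
  elim: a => [|a IH] //=.
  have := D (shift o a); have := D o; rewrite IH.
  by case: (odd a) => /=; lia.
have [m0|m0] := posnP (m (rim_edge o)); [right|left] => x /rim_half_mem[k /eqP ko ->].
  by rewrite all ko m0.
by rewrite all ko.
Qed.

(** * Generators of the ideal of the wheel *)

(** J stands for any ideal that contains the proposed generators. *)
Section Generation.
Variables (K : fieldType) (J : edge_ring K W -> Prop).
Hypotheses (J0 : J 0) (JD : forall p q, J p -> J q -> J (p + q))
  (JM : forall a p, J p -> J (a * p))
  (Jquad : forall i, J ('X_[quad_l i] - 'X_[quad_r i]))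
  (Jtri : forall i j, j != i -> j != ordS i -> i != ordS j ->
     J ('X_[tri i j] - 'X_[tri j i]))
  (Jrim : ~~ odd n -> J ('X_[rim_half false] - 'X_[rim_half true])).

Let J_sym m m' : J ('X_[m] - 'X_[m']) -> J ('X_[m'] - 'X_[m]).
Proof. by move/(JM (-1)); rewrite mulN1r opprB. Qed.

Definition fibre_move m m' := vdeg m =1 vdeg m' /\ J ('X_[m] - 'X_[m']).

(** Replacing the factor a of m1 by b creates a common factor with m2. *)
Definition reducible m1 m2 := exists a b, [/\ fibre_move a b, (a <= m1)%MM
  & exists x, (0 < b x)%N && (0 < m2 x)%N].

(** Say s_i divides m1.  Then s_i does not divide m2, so the degree at i provides
r_i or r_(i-1) in m2.  If r_i is in m2, it is not in m1, and the degree at i+1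
provides s_(i+1) or r_(i+1) in m1; with r_(i+1), the quadric s_i r_(i+1) -
s_(i+2) r_i brings r_i into m1.  The other case is the mirror image. *)
Lemma spoke_reducible m1 m2 i : vdeg m1 =1 vdeg m2 ->
  (forall x, m1 x = 0 \/ m2 x = 0)%N -> (0 < m1 (spoke i))%N ->
  reducible m1 m2 \/ exists k, [/\ 0 < m1 (spoke k), 0 < m1 (spoke (ordS k))
    & 0 < m2 (rim_edge k)]%N.
Proof.
move=> e dis; rewrite -(ord_predK i); move: (ord_pred i) => k m1i.
have S1 : m2 (spoke (ordS k)) = 0%N by have := dis (spoke (ordS k)); lia.
have [r2|r2] := posnP (m2 (rim_edge k)); last first.
  have r1 : m1 (rim_edge k) = 0%N by have := dis (rim_edge k); lia.
  have [l kl] : exists l, k = ordS l by exists (ord_pred k); rewrite ord_predK.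
  subst k; have := e (rim (ordS l)); rewrite !vdeg_rim => el.
  have [s1|s1] := posnP (m1 (spoke (ordS l))); last first.
    by right; exists (ordS l).
  left; exists (quad_r l), (quad_l l); split.
  - by split; [move=> v; rewrite quad_vdeg|apply: J_sym].
  - apply: sqf_le; first by rewrite /= inE spoke_rim_edge.
    by move=> x; rewrite !inE => /orP[]/eqP->; lia.
  - by exists (rim_edge (ordS l)); rewrite sqf_gt0 !inE eqxx orbT.
have := e (rim (ordS k)); rewrite !vdeg_rim => ek.
have r2' : (0 < m2 (rim_edge (ordS k)))%N by lia.
have r1' : m1 (rim_edge (ordS k)) = 0%N by have := dis (rim_edge (ordS k)); lia.
have := e (rim (ordS (ordS k))); rewrite !vdeg_rim => el.
have [s1|s1] := posnP (m1 (spoke (ordS (ordS k)))); last first.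
  by right; exists (ordS k).
left; exists (quad_l (ordS k)), (quad_r (ordS k)); split.
- by split; [exact: quad_vdeg|].
- apply: sqf_le; first by rewrite /= inE spoke_rim_edge.
  by move=> x; rewrite !inE => /orP[]/eqP->; lia.
- by exists (rim_edge (ordS k)); rewrite sqf_gt0 !inE eqxx orbT.
Qed.

(** Without spokes, coprimality and the degrees on the rim make the rim edges
divide m1 and m2 alternately.  Going once around the rim is contradictory for
odd n, and shows that the two halves of the rim divide m1 and m2 for even n. *)
Lemma rim_reducible m1 m2 : vdeg m1 =1 vdeg m2 ->
  (forall x, m1 x = 0 \/ m2 x = 0)%N -> (forall i, m1 (spoke i) = 0%N) ->
  (forall i, m2 (spoke i) = 0%N) -> m1 = 0%MM \/ reducible m1 m2.
Proof.
move=> e dis s1 s2.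
have [->|ne] := eqVneq m1 0%MM; [by left|right].
have [i0 r0] : exists i, (0 < m1 (rim_edge i))%N.
  apply/existsP; apply: contraNT ne; rewrite negb_exists => /forallP all.
  apply/eqP/mnmP => x; rewrite mnm0E.
  case: (wheel_edge_cases x) => -[i ->]; first exact: s1.
  by have := all i; rewrite lt0n negbK => /eqP.
have alt a : if odd a then (0 < m2 (rim_edge (shift i0 a)))%N
             else (0 < m1 (rim_edge (shift i0 a)))%N.
  elim: a => //= a; have := e (rim (ordS (shift i0 a))).
  rewrite !vdeg_rim s1 s2.
  have := dis (rim_edge (shift i0 a)); have := dis (rim_edge (ordS (shift i0 a))).
  by case: (odd a) => /=; lia.
have en : ~~ odd n.
  apply/negP => on; have := alt n; rewrite on shift_n.
  by have := dis (rim_edge i0); lia.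
exists (rim_half (odd i0)), (rim_half (~~ odd i0)); split.
- split=> [v|]; first by rewrite !vdeg_rim_half.
  by case: (odd i0) => /=; [apply: J_sym|]; apply: Jrim.
- apply: sqf_le; first exact: rim_half_uniq.
  move=> x /rim_half_mem[k ko ->]; have [a _ ka] := shift_ex i0 k.
  have := alt a; rewrite -ka; move: ko; rewrite ka odd_shift //.
  by case: (odd i0); case: (odd a).
- exists (rim_edge (ordS i0)); have /= r1 := alt 1%N; rewrite rim_half_edge r1 andbT.
  by rewrite (odd_shift i0 1 en : odd (ordS i0) = _) addbT eqxx.
Qed.

(** The induction is on the sum of all vertex degrees, which is constant on a
fibre and drops when a common factor is cancelled.  If no quadric applies to
either monomial, spoke_reducible gives a pair of consecutive spokes in each of
them and the rim edge between these spokes in the other, so the binomial of two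
triangles applies; coprimality makes the triangles disjoint outside the hub. *)
Lemma fibre_connected m1 m2 : vdeg m1 =1 vdeg m2 -> J ('X_[m1] - 'X_[m2]).
Proof.
have [N] := ubnP (\sum_v vdeg m1 v)%N; elim: N m1 m2 => // N IH m1 m2 ltN e.
have common a b x : (\sum_v vdeg a v < N.+1)%N -> vdeg a =1 vdeg b ->
    (0 < a x)%N -> (0 < b x)%N -> J ('X_[a] - 'X_[b]).
  move=> lta eab ax bx.
  have la : (U_(x) <= a)%MM by rewrite lep1mP -lt0n.
  have lb : (U_(x) <= b)%MM by rewrite lep1mP -lt0n.
  rewrite -(submK la) -(submK lb) !mpolyXD -mulrBl mulrC; apply: JM; apply: IH.
    apply: leq_trans (_ : (\sum_v vdeg a v <= N)%N); last by rewrite -ltnS.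
    have [v0 v0x] := edge_end x; have := leq_vdeg a v0x.
    rewrite [X in (X < _)%N](bigD1 v0) // [X in (_ < X)%N](bigD1 v0) //=.
    rewrite vdegB // vdegU v0x.
    move=> av; rewrite -addSn leq_add //; first by rewrite subn1 (ltn_predK (leq_trans ax av)).
    by apply: leq_sum => v _; rewrite vdegB // leq_subr.
  by move=> v; rewrite !vdegB // eab.
have red a b : (\sum_v vdeg a v < N.+1)%N -> vdeg a =1 vdeg b ->
    reducible a b -> J ('X_[a] - 'X_[b]).
  move=> lta eab [c [d [[ecd Jcd] lec [x /andP[dx bx]]]]].
  pose a' := (a - c + d)%MM.
  have ea : vdeg a =1 vdeg a' by move=> v; rewrite -{1}(submK lec) !vdegD ecd.
  rewrite -(subrKA 'X_[a']) addrC; apply: JD.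
    apply: (common _ _ x) => //; last by rewrite mnmDE; lia.
      by rewrite -(eq_bigr _ (fun v _ => ea v)).
    by move=> v; rewrite -ea.
  by have := JM 'X_[a - c] Jcd; rewrite mulrBr -!mpolyXD submK.
have [/existsP[x /andP[]]|] := boolP [exists x, (0 < m1 x)%N && (0 < m2 x)%N].
  exact: common.
rewrite negb_exists => /forallP dis'.
have dis x : m1 x = 0%N \/ m2 x = 0%N by have := dis' x; lia.
have dis2 x : m2 x = 0%N \/ m1 x = 0%N by have := dis x; lia.
have e' := fsym e.
have lt2 : (\sum_v vdeg m2 v < N.+1)%N by rewrite -(eq_bigr _ (fun v _ => e v)).
have hub := e ord_max; rewrite !vdeg_hub in hub.
have [/existsP[i si]|] := boolP [exists i, (0 < m1 (spoke i))%N]; last first.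
  rewrite negb_exists => /forallP s1'.
  have s1 i : m1 (spoke i) = 0%N by have := s1' i; lia.
  have s2 i : m2 (spoke i) = 0%N.
    move/esym/eqP: hub; rewrite [X in _ == X]big1 // sum_nat_eq0.
    by move=> /forallP/(_ i)/eqP.
  have [m10|] := rim_reducible e dis s1 s2; last exact: red.
  suff -> : m2 = m1 by rewrite subrr.
  by rewrite m10; apply: vdeg_eq0 => v; rewrite -e m10 vdeg0.
have [j sj] : exists j, (0 < m2 (spoke j))%N.
  apply/existsP; apply: contraT; rewrite negb_exists => /forallP all.
  move/eqP: hub; rewrite [X in _ == X]big1 ?sum_nat_eq0.
    by move/forallP/(_ i)/eqP => si0; rewrite si0 in si.
  by move=> j _; have := all j; lia.
have [r|[k [k1 k2 k3]]] := spoke_reducible e dis si; first exact: red.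
have [r|[l [l1 l2 l3]]] := spoke_reducible e' dis2 sj; first by apply/J_sym/red.
apply: red => //; exists (tri k l), (tri l k); split.
- split; first exact: tri_vdeg.
  by apply: Jtri; apply/eqP => kl; [have := dis (spoke k)|
     have := dis (spoke l)|have := dis (spoke k)];
     move: k1 k2 l1 l2; rewrite kl; lia.
- apply: sqf_le; first by rewrite /= !inE !spoke_eq !spoke_rim_edge ordS_neq.
  by move=> x; rewrite !inE => /or3P[]/eqP->.
- by exists (spoke l); rewrite sqf_gt0 !inE eqxx.
Qed.

Lemma wheel_toric_generated p : toric_ideal p -> J p.
Proof.
move=> pI; apply: (toric_ind J p J0 JD pI) => c m m' _ _ e.
by rewrite -mul_mpolyC; apply/JM/fibre_connected.
Qed.

End Generation.

(** * Triangles at distance two *)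

Lemma addmCA (k : nat) (a b c : 'X_{1..k}) : (a + (b + c) = b + (a + c))%MM.
Proof. by rewrite !addmA [(b + a)%MM]addmC. Qed.

(** With k = i+2: s_i s_(i+1) r_k becomes s_i s_(k+1) r_(i+1) by the quadric at
i+1, and then s_k s_(k+1) r_i by the quadric at i. *)
Lemma tri_gap_two (K : fieldType) (J : edge_ring K W -> Prop) i :
  (forall p q, J p -> J q -> J (p + q)) -> (forall a p, J p -> J (a * p)) ->
  (forall k, J ('X_[quad_l k] - 'X_[quad_r k])) ->
  J ('X_[tri i (ordS (ordS i))] - 'X_[tri (ordS (ordS i)) i]).
Proof.
move=> JD JM Jq; pose k := ordS (ordS i).
have := JD _ _ (JM 'X_(spoke i) _ (Jq (ordS i))) (JM 'X_(spoke (ordS k)) _ (Jq i)).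
rewrite !mulrBr -!mpolyXD.
have -> : (U_(spoke (ordS k)) + quad_l i = U_(spoke i) + quad_r (ordS i))%MM.
  by rewrite /quad_l /quad_r /sqf !big_cons big_nil !addm0 addmCA.
rewrite addrA subrK /quad_l /quad_r /tri /sqf !big_cons big_nil !addm0.
by rewrite [(U_(spoke (ordS k)) + _)%MM]addmCA.
Qed.

(** * No splitting for even n >= 6 *)

Section NoSplitting.
Hypotheses (en : ~~ odd n) (n6 : (6 <= n)%N).

Definition linked x y := exists m1 m2 : 'X_{1..#|edges W|},
  [/\ two_fibre m1 m2, (0 < m1 x + m2 x)%N & (0 < m1 y + m2 y)%N].

Lemma linked_sym x y : linked x y -> linked y x.
Proof. by case=> m1 [m2 [? ? ?]]; exists m1, m2. Qed.

Lemma sqf_linked l1 l2 x y : two_fibre (sqf l1) (sqf l2) ->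
  x \in l1 ++ l2 -> y \in l1 ++ l2 -> linked x y.
Proof.
move=> tf xl yl; exists (sqf l1), (sqf l2); split=> //.
  by rewrite addn_gt0 !sqf_gt0 -mem_cat.
by rewrite addn_gt0 !sqf_gt0 -mem_cat.
Qed.

Lemma quad_linked i x y :
  x \in [:: spoke i; rim_edge (ordS i); spoke (ordS (ordS i)); rim_edge i] ->
  y \in [:: spoke i; rim_edge (ordS i); spoke (ordS (ordS i)); rim_edge i] ->
  linked x y.
Proof.
have n4 : (4 <= n)%N by apply: leq_trans n6.
exact: (sqf_linked (quad_two_fibre i n4)).
Qed.

Lemma tri_linked i d x y : (3 <= d)%N -> (d + 3 <= n)%N ->
  let l := [:: spoke i; spoke (ordS i); rim_edge (shift i d);
      spoke (shift i d); spoke (shift i d.+1); rim_edge i] in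
  x \in l -> y \in l -> linked x y.
Proof. by move=> d3 dn; apply: (sqf_linked (tri_two_fibre i d3 dn)). Qed.

Lemma rim_linked i j : linked (rim_edge i) (rim_edge j).
Proof.
apply: (sqf_linked (rim_two_fibre en)); rewrite mem_cat;
  apply/orP; rewrite -!sqf_gt0 -/(rim_half _) !rim_half_edge.
  by case: (odd i); [right|left].
by case: (odd j); [right|left].
Qed.

(** With i = j + d, the pair lies in the triangles at j and j+3 for d = 0, 1, in a
quadric for d = 2 and d = n-1, in the triangles at j and i for 3 <= d <= n-3,
and in the triangles at j and i-1 for d = n-2. *)
Lemma spoke_rim_linked i j : linked (spoke i) (rim_edge j).
Proof.
have [d ltd ->] := shift_ex j i.
have [?|?] := leqP d 1%N.
  have : (d = 0 \/ d = 1)%N by lia.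
  by case=> ->; apply: (@tri_linked j 3); rewrite ?inE ?eqxx ?orbT //; lia.
have [->|?] := eqVneq d 2%N; first by apply: (@quad_linked j); rewrite ?inE ?eqxx ?orbT.
have [?|?] := leqP (d + 3) n.
  by apply: (@tri_linked j d); rewrite ?inE ?eqxx ?orbT //; lia.
have [d2|d2] := eqVneq (d + 2)%N n.
  have -> : d = d.-1.+1 by lia.
  by apply: (@tri_linked j d.-1); rewrite ?inE ?eqxx ?orbT //; lia.
have dn : d.+1 = n by lia.
have {2}-> : j = ordS (shift j d) by rewrite -[RHS]/(shift j d.+1) dn shift_n.
by apply: (@quad_linked (shift j d)); rewrite ?inE ?eqxx ?orbT.
Qed.

Lemma spoke_linked i j : linked (spoke i) (spoke j).
Proof.
have [d ltd ->] := shift_ex i j.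
have [?|?] := leqP d 1%N.
  have : (d = 0 \/ d = 1)%N by lia.
  by case=> ->; apply: (@tri_linked i 3); rewrite ?inE ?eqxx ?orbT //; lia.
have [->|?] := eqVneq d 2%N; first by apply: (@quad_linked i); rewrite ?inE ?eqxx ?orbT.
have [?|?] := leqP (d + 3) n.
  by apply: (@tri_linked i d); rewrite ?inE ?eqxx ?orbT //; lia.
have [d2|d2] := eqVneq (d + 2)%N n.
  have {1}-> : i = ordS (ordS (shift i d)).
    by rewrite -[RHS]/(shift i d.+2) -addn2 d2 shift_n.
  by apply: (@quad_linked (shift i d)); rewrite ?inE ?eqxx ?orbT.
have dn : d.+1 = n by lia.
have {1}-> : i = ordS (shift i d) by rewrite -[RHS]/(shift i d.+1) dn shift_n.
by apply: (@tri_linked (shift i d) 3); rewrite ?inE ?eqxx ?orbT //; lia.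
Qed.

Lemma all_linked x y : linked x y.
Proof.
case: (wheel_edge_cases x) => -[i ->]; case: (wheel_edge_cases y) => -[j ->].
- exact: spoke_linked.
- exact: spoke_rim_linked.
- exact/linked_sym/spoke_rim_linked.
- exact: rim_linked.
Qed.

Lemma wheel_not_splittable (K : fieldType) : ~ subgraph_splittable K W.
Proof.
case=> G1 [G2 [s1 [s2 [eI ne1 ne2]]]].
have [x x1] := ext_toric_missing_edge ne1; have [y y2] := ext_toric_missing_edge ne2.
have [m1 [m2 [tf mx my]]] := all_linked x y.
have := two_fibre_split eI tf mx my.
by rewrite (negPf x1) (negPf y2); case.
Qed.

End NoSplitting.

(** * Splittings by deleting one edge on each side *)

Section DeleteTwoEdges.
Variable K : fieldType.

Lemma del_edge_proper x : ~ ideal_eq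
  (ext_toric_ideal (del_edge_sub x)) (@toric_ideal K _ W).
Proof.
have neq i : quad_l i != quad_r i.
  apply/eqP => /mnmP/(_ (spoke i))/eqP; rewrite !sqfE /= !spoke_eq ordSS_neqC.
  by rewrite !rim_edge_spoke eqxx.
have notE : enum_val x \notin edges (del_edge x) by rewrite !inE eqxx.
move=> eI; case: (wheel_edge_cases x) => -[i xi].
  have /eI/(quadric_coef0 (rim_edge (ordS i)) notE)/eqP := toric_binomial K (quad_vdeg i).
  have -> : (U_(x) + U_(rim_edge (ordS i)) = quad_l i)%MM.
    by rewrite xi /quad_l /sqf !big_cons big_nil addm0.
  by rewrite mcoeffB !mcoeffX eqxx [quad_r i == _]eq_sym (negPf (neq i)) subr0 oner_eq0.
have /eI/(quadric_coef0 (spoke (ordS (ordS i))) notE)/eqP := toric_binomial K (quad_vdeg i).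
have -> : (U_(x) + U_(spoke (ordS (ordS i))) = quad_r i)%MM.
  by rewrite xi addmC /quad_r /sqf !big_cons big_nil addm0.
by rewrite mcoeffB !mcoeffX eqxx (negPf (neq i)) sub0r oppr_eq0 oner_eq0.
Qed.

Variables x y : 'I_#|edges W|.
Let J : edge_ring K W -> Prop := ideal_add
  (ext_toric_ideal (del_edge_sub x)) (ext_toric_ideal (del_edge_sub y)).

Lemma del2_add p q : J p -> J q -> J (p + q).
Proof.
case=> [a [b [Ia Ib ->]]] [c [d [Ic Id ->]]]; exists (a + c), (b + d).
by split; [exact: ext_toricD|exact: ext_toricD|rewrite addrACA].
Qed.

Lemma del2_mul a p : J p -> J (a * p).
Proof.
case=> [b [c [Ib Ic ->]]]; exists (a * b), (a * c).
by split; [exact: ext_toricMl|exact: ext_toricMl|rewrite mulrDr].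
Qed.

Lemma del2_0 : J 0.
Proof. by exists 0, 0; split; rewrite ?addr0 //; apply: ext_toric0. Qed.

Lemma del2_binomial m m' : vdeg m =1 vdeg m' ->
  (m x = 0 /\ m' x = 0 \/ m y = 0 /\ m' y = 0)%N -> J ('X_[m] - 'X_[m']).
Proof.
move=> e [[mx m'x]|[my m'y]].
  exists ('X_[m] - 'X_[m']), 0; split; rewrite ?addr0 //; last exact: ext_toric0.
  by apply: ext_toric_binomial => //; apply: supported_del.
exists 0, ('X_[m] - 'X_[m']); split; rewrite ?add0r //; first exact: ext_toric0.
by apply: ext_toric_binomial => //; apply: supported_del.
Qed.

Lemma del2_split : (forall p, toric_ideal p -> J p) -> subgraph_splittable K W.
Proof.
move=> gen; exists (del_edge x), (del_edge y), (del_edge_sub x), (del_edge_sub y).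
split; [|exact: del_edge_proper|exact: del_edge_proper].
move=> p; split; first exact: gen.
by case=> a [b [/ext_toric_sub Ia /ext_toric_sub Ib ->]]; apply: toricD.
Qed.

End DeleteTwoEdges.

(** The deleted edges are r_0 and r_2.  The quadric at i involves r_i and r_(i+1),
which are r_2 and r_0 only for n = 3 and i = 2. *)
Lemma wheel_splittable_odd (K : fieldType) : odd n -> subgraph_splittable K W.
Proof.
move=> on; have n0 : (0 < n)%N by lia.
pose i0 := Ordinal n0; pose i2 := ordS (ordS i0).
pose x := rim_edge i0; pose y := rim_edge i2.
pose J : edge_ring K W -> Prop := ideal_add
  (ext_toric_ideal (del_edge_sub x)) (ext_toric_ideal (del_edge_sub y)).
have JD : forall p q, J p -> J q -> J (p + q) by exact: del2_add.
have JM : forall a p, J p -> J (a * p) by exact: del2_mul.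
have Jsym m m' : J ('X_[m] - 'X_[m']) -> J ('X_[m'] - 'X_[m]).
  by move/(JM (-1)); rewrite mulN1r opprB.
have avoid i : (i0 != i) && (i0 != ordS i) || (i2 != i) && (i2 != ordS i) ->
    J ('X_[quad_l i] - 'X_[quad_r i]).
  move=> h; apply: del2_binomial; first exact: quad_vdeg.
  rewrite !sqfE /= !spoke_rim_edge !rim_edge_eq !add0n !addn0.
  by rewrite ![_ == i0]eq_sym ![_ == i2]eq_sym; lia.
have Jq0 : J ('X_[quad_l i0] - 'X_[quad_r i0]).
  apply: avoid; rewrite (ordSS_neqC i0 : (i2 == i0) = false).
  by rewrite (ordS_neqC (ordS i0) : (i2 == ordS i0) = false) orbT.
have Jq1 : J ('X_[quad_l (ordS i0)] - 'X_[quad_r (ordS i0)]).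
  by apply: avoid; rewrite ordS_neq ordSS_neq.
have Jq i : J ('X_[quad_l i] - 'X_[quad_r i]).
  have [->|n2] := eqVneq i i2.
    have [n3|n3] := eqVneq n 3%N.
      (* Now the three terms s_i r_(i+1) are the terms of all three quadrics,
         whose sum is 0. *)
      have s3 k : ordS (ordS (ordS k)) = k.
        by rewrite -[LHS]/(shift k 3) -[X in shift k X]n3 shift_n.
      have q3 k : quad_r k = quad_l (ordS (ordS k)).
        by rewrite /quad_l s3.
      have := JD _ _ Jq0 Jq1; rewrite !q3 s3 addrC addrA subrK; exact: Jsym.
    apply: avoid; rewrite ordSS_neq.
    by rewrite (_ : (i0 == ordS i2) = false) //; apply: (@shift_neq i0 0 3); lia.
  have [->|n1] := eqVneq i (ordS i0); first exact: Jq1.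
  apply: avoid; rewrite [i2 == i]eq_sym (negPf n2) /=.
  by rewrite (inj_eq (@ordS_inj n)) [ordS i0 == i]eq_sym (negPf n1) orbT.
apply: (@del2_split K x y); apply: wheel_toric_generated => //.
- exact: del2_0.
- move=> i j ij _ _; rewrite -/(J _).
  have [/andP[/eqP-> /eqP->]|n02] := boolP ((i == i0) && (j == i2)).
    exact: tri_gap_two.
  have [/andP[/eqP-> /eqP->]|n20] := boolP ((i == i2) && (j == i0)).
    by apply: Jsym; exact: tri_gap_two.
  have ne k : ~~ ((k == i0) && (k == i2)).
    by have [->|] := eqVneq k i0; rewrite //= (ordSS_neq i0 : (i0 == i2) = false).
  have nij k : ~~ ((i == k) && (j == k)).
    by apply/negP => /andP[/eqP ik /eqP jk]; move: ij; rewrite ik jk eqxx.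
  apply: del2_binomial; first exact: tri_vdeg.
  rewrite !sqfE /= !spoke_rim_edge !rim_edge_eq !add0n !addn0.
  by have := ne i; have := ne j; have := nij i0; have := nij i2; lia.
- by rewrite on.
Qed.

(** The deleted edges are s_0 and s_1.  The quadric at i has the spokes s_i and
s_(i+2), so it avoids one of them; disjoint triangles are at distance two, and
the rim has no spokes. *)
Lemma wheel_splittable_4 (K : fieldType) : n = 4%N -> subgraph_splittable K W.
Proof.
move=> n4; have n0 : (0 < n)%N by lia.
pose i0 := Ordinal n0; pose x := spoke i0; pose y := spoke (ordS i0).
have s4 k : ordS (ordS (ordS (ordS k))) = k.
  by rewrite -[LHS]/(shift k 4) -[X in shift k X]n4 shift_n.
pose J : edge_ring K W -> Prop := ideal_add
  (ext_toric_ideal (del_edge_sub x)) (ext_toric_ideal (del_edge_sub y)).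
have Jq i : J ('X_[quad_l i] - 'X_[quad_r i]).
  apply: del2_binomial; first exact: quad_vdeg.
  rewrite !sqfE /= !rim_edge_spoke !spoke_eq !addn0.
  have [a lta ->] := shift_ex i0 i.
  rewrite -[ordS (ordS (shift i0 a))]/(shift i0 a.+2).
  have e0 b : (shift i0 b == i0) = (b %% 4 == 0)%N.
    have -> : (b %% 4 == 0)%N = (b == 0 %[mod n])%N by rewrite n4.
    exact: (shift_eq i0 b 0).
  have e1 b : (shift i0 b == ordS i0) = (b %% 4 == 1)%N.
    have -> : (b %% 4 == 1)%N = (b == 1 %[mod n])%N by rewrite n4.
    exact: (shift_eq i0 b 1).
  rewrite !e0 !e1; have : (a < 4)%N by rewrite -n4.
  by case: a {lta} => [|[|[|[|//]]]] _ /=; auto.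
apply: (@del2_split K x y); apply: wheel_toric_generated => //.
- exact: del2_0.
- exact: del2_add.
- exact: del2_mul.
- move=> i j ij ijS jiS.
  have -> : j = ordS (ordS i).
    have [a lta ja] := shift_ex i j; have : (a < 4)%N by rewrite -n4.
    move: ij ijS jiS; rewrite ja; case: a {lta ja} => [|[|[|[|//]]]] //=.
    - by rewrite eqxx.
    - by rewrite eqxx.
    - by rewrite s4 eqxx.
  apply: tri_gap_two => //; [exact: del2_add|exact: del2_mul].
- move=> en; apply: del2_binomial; first by move=> v; rewrite !vdeg_rim_half.
  by left; rewrite !rim_half_spoke.
Qed.

End Wheel.

Theorem theorem2p14 (K : fieldType) (n : nat) (hn : (3 <= n)%N) :
  (~~ odd n -> (subgraph_splittable K (wheel hn) <-> n = 4%N)) /\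
  (odd n -> subgraph_splittable K (wheel hn)).
Proof.
split=> [en|]; last exact: wheel_splittable_odd.
split=> [spl|]; last exact: wheel_splittable_4.
apply/eqP; apply: contraT => n4.
have n6 : (6 <= n)%N.
  by case: n hn en n4 {spl} => [|[|[|[|[|[|k]]]]]].
by have := wheel_not_splittable en n6 spl.
Qed.
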